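(* Let $\Phi\subseteq\{I,O,U,\mathit{Self},Q_n,N_n\mid n\in\mathbb N\setminus\{0\}\}$, let $\mathcal T$ be a fuzzy TBox in $\mathcal L^{\sim}_\Phi$, and let $\mathcal I$, $\mathcal I'$ be fuzzy interpretations that are witnessed w.r.t. $\mathcal L^{\sim}_\Phi$ and strongly $\Phi$-bisimilar to each other. If $\mathcal I$ and $\mathcal I'$ are connected w.r.t. $\Phi$, then $\mathcal I\models\mathcal T$ iff $\mathcal I'\models\mathcal T$.
   Context: Gödel operations on $[0,1]$: $p\otimes q=\min\{p,q\}$, $p\oplus q=\max\{p,q\}$, $\ominus p=1$ if $p=0$ and $0$ otherwise, $(p\Rightarrow q)=1$ if $p\le q$ and $q$ otherwise, $(p\Leftrightarrow q)=(p\Rightarrow q)\otimes(q\Rightarrow p)$. Fix pairwise disjoint sets $\mathsf{CN}$, $\mathsf{RN}$, $\mathsf{IN}$ of concept, role and individual names. A basic role w.r.t. $\Phi$ is $r\in\mathsf{RN}$, or $r^-$ when $I\in\Phi$. Roles and concepts of $\mathcal L^{\sim}_\Phi$: each $r\in\mathsf{RN}$ is a role; if $R,S$ are roles and $C$ a concept then $R\circ S$, $R\sqcup S$, $R^*$, $C?$ are roles; $R^-$ if $I\in\Phi$; $U$ if $U\in\Phi$; concepts: $p\in[0,1]$, $A\in\mathsf{CN}$, $C\sqcap D$, $C\to D$, $\neg C$, $C\sqcup D$, $\mathord{\sim}C$, $\forall R.C$, $\exists R.C$; $\{a\}$ if $O\in\Phi$; $\exists r.\mathit{Self}$ if $\mathit{Self}\in\Phi$;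 ${\ge}n\,R.C$, ${<}n\,R.C$ for basic $R$ if $Q_n\in\Phi$; ${\ge}n\,R$, ${<}n\,R$ for basic $R$ if $N_n\in\Phi$. $\top$ is concept $1$. A fuzzy interpretation $\mathcal I$ has a nonempty domain $\Delta^{\mathcal I}$, $a^{\mathcal I}\in\Delta^{\mathcal I}$, $A^{\mathcal I}:\Delta^{\mathcal I}\to[0,1]$, $r^{\mathcal I}:(\Delta^{\mathcal I})^2\to[0,1]$, extended by: $U^{\mathcal I}\equiv1$; $(R^-)^{\mathcal I}(x,y)=R^{\mathcal I}(y,x)$; $(C?)^{\mathcal I}(x,y)=C^{\mathcal I}(x)$ if $x=y$, else $0$; $(R\circ S)^{\mathcal I}(x,y)=\sup_z R^{\mathcal I}(x,z)\otimes S^{\mathcal I}(z,y)$; $(R\sqcup S)^{\mathcal I}=R^{\mathcal I}\oplus S^{\mathcal I}$; $(R^* )^{\mathcal I}(x,y)=\sup\{\min(\{1\}\cup\{R^{\mathcal I}(x_i,x_{i+1})\mid i<n\})\mid n\ge0,x_0=x,x_n=y\}$; $p^{\mathcal I}(x)=p$; $\{a\}^{\mathcal I}(x)=1$ iff $x=a^{\mathcal I}$, else $0$; $(\neg C)^{\mathcal I}=\ominus C^{\mathcal I}$; $(\mathord{\sim}C)^{\mathcal I}(x)=1-C^{\mathcal I}(x)$; $\sqcap,\sqcup,\to$ pointwise by $\otimes,\oplus,\Rightarrow$; $(\exists r.\mathit{Self})^{\mathcal I}(x)=r^{\mathcal I}(x,x)$; $(\exists R.C)^{\mathcal I}(x)=\sup_y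 R^{\mathcal I}(x,y)\otimes C^{\mathcal I}(y)$; $(\forall R.C)^{\mathcal I}(x)=\inf_y(R^{\mathcal I}(x,y)\Rightarrow C^{\mathcal I}(y))$; $({\ge}n\,R.C)^{\mathcal I}(x)=\sup\{\min_i(R^{\mathcal I}(x,y_i)\otimes C^{\mathcal I}(y_i))\mid y_1..y_n$ pairwise distinct$\}$; $({<}n\,R.C)^{\mathcal I}(x)=\inf\{\min_i(R^{\mathcal I}(x,y_i)\otimes C^{\mathcal I}(y_i))\Rightarrow e\mid y_1..y_n\}$ with $e=1$ if some $y_j=y_k$ ($j<k$), else $0$; ${\ge}n\,R={\ge}n\,R.\top$, ${<}n\,R={<}n\,R.\top$. Witnessed w.r.t. $\mathcal L^{\sim}_\Phi$: for roles/concepts of $\mathcal L^{\sim}_\Phi$, every infinite set whose infimum (supremum) is taken above has a least (greatest) element. $\mathcal I$ is connected w.r.t. $\Phi$ if for every $x\in\Delta^{\mathcal I}$ there exist $a\in\mathsf{IN}$, $x_0,\dots,x_n\in\Delta^{\mathcal I}$ and basic roles $R_1,\dots,R_n$ w.r.t. $\Phi$ with $x_0=a^{\mathcal I}$, $x_n=x$ and $R_i^{\mathcal I}(x_{i-1},x_i)>0$ for all $1\le i\le n$. A fuzzy GCI in $\mathcal L^{\sim}_\Phi$ is $(C\sqsubseteq D)\rhd p$ with $C,D$ concepts of $\mathcal L^{\sim}_\Phi$, $\rhd\in\{\ge,>\}$, $p\in(0,1]$; $\mathcal I\models(C\sqsubseteq D)\rhd p$ iff $(C\to D)^{\mathcal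 I}(x)\rhd p$ for all $x$. A fuzzy TBox is a finite set of fuzzy GCIs; $\mathcal I\models\mathcal T$ iff it validates all of them. A crisp $\Phi$-bisimulation between $\mathcal I,\mathcal I'$ is $Z:\Delta^{\mathcal I}\times\Delta^{\mathcal I'}\to\{0,1\}$ such that, for all $x,x',A,a,r$ and basic $R$: (i) $Z(x,x')\le(A^{\mathcal I}(x)\Leftrightarrow A^{\mathcal I'}(x'))$; (ii) $\forall y\exists y'$: $Z(x,x')\otimes R^{\mathcal I}(x,y)\le Z(y,y')\otimes R^{\mathcal I'}(x',y')$; (iii) $\forall y'\exists y$: $Z(x,x')\otimes R^{\mathcal I'}(x',y')\le Z(y,y')\otimes R^{\mathcal I}(x,y)$; (iv) if $O\in\Phi$: $Z(x,x')=0$ whenever exactly one of $x=a^{\mathcal I}$, $x'=a^{\mathcal I'}$ holds; (v) if $U\in\Phi$: $\forall y\exists y'$ $Z(x,x')\le Z(y,y')$ and $\forall y'\exists y$ $Z(x,x')\le Z(y,y')$; (vi) if $\mathit{Self}\in\Phi$: $Z(x,x')\le(r^{\mathcal I}(x,x)\Leftrightarrow r^{\mathcal I'}(x',x'))$; (vii) if $Q_n\in\Phi$: if $Z(x,x')>0$ and $y_1..y_n$ pairwise distinct with all $R^{\mathcal I}(x,y_j)>0$, there exist pairwise distinct $y'_1..y'_n$ such that for each $i$ some $j$ has $Z(x,x')\otimes\bigotimes_k R^{\mathcal I}(x,y_k)\le Z(y_j,y'_i)\otimes R^{\mathcal I'}(x',y'_i)$, and symmetrically (from pairwise distinct $y'_1..y'_n$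 with $R^{\mathcal I'}(x',y'_j)>0$ obtain pairwise distinct $y_1..y_n$ such that for each $i$ some $j$ has $Z(x,x')\otimes\bigotimes_k R^{\mathcal I'}(x',y'_k)\le Z(y_i,y'_j)\otimes R^{\mathcal I}(x,y_i)$); (viii) if $N_n\in\Phi$: as (vii) with right-hand sides $R^{\mathcal I'}(x',y'_i)$ for all $i$, resp. $R^{\mathcal I}(x,y_i)$ for all $i$. $\mathcal I$ and $\mathcal I'$ are strongly $\Phi$-bisimilar if $\mathsf{IN}\ne\emptyset$ and there is a crisp $\Phi$-bisimulation $Z$ between them with $Z(a^{\mathcal I},a^{\mathcal I'})=1$ for all $a\in\mathsf{IN}$. *)

(* Defs.v *)
From HB Require Import structures.
From mathcomp Require Import all_boot all_order all_algebra.
From mathcomp Require Import all_classical all_reals interval_inference.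

Set Implicit Arguments.
Unset Strict Implicit.
Unset Printing Implicit Defensive.

Import Order.TTheory GRing.Theory Num.Theory.

Local Open Scope classical_set_scope.
Local Open Scope ring_scope.

Inductive feature : Type :=
| FI | FO | FU | FSelf | FQ of nat | FN of nat.

Definition features : set feature :=
  [set f | match f with FQ n | FN n => (0 < n)%N | _ => True end].

Section Goedel.
Context (R : realType).
Implicit Types p q : R.

Definition gand p q : R := Num.min p q.
Definition gor p q : R := Num.max p q.
Definition gneg p : R := if p == 0 then 1 else 0.
Definition gimp p q : R := if p <= q then 1 else q.
Definition giff p q : R := gand (gimp p q) (gimp q p).

(* The minimum of finitely many elements of [0, 1]: the default value 1 only
   matters for the empty family, whose minimum is then 1. *)
Definition gmin (n : nat) (f : 'I_n -> R) : R := \big[gand/1]_(i < n) f i.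

Definition has_least (A : set R) : Prop := exists m, A m /\ lbound A m.
Definition has_greatest (A : set R) : Prop := exists m, A m /\ ubound A m.

End Goedel.

(* Concept, role and individual names are the elements of three distinct types,
   hence disjoint.  The syntax below contains the constructors of all the
   features; the language of a set of features Phi is carved out by [role_in]
   and [concept_in]. *)
Section Syntax.
Context (R : realType) (CN RN IN : Type).

Inductive role : Type :=
| RName of RN
| RComp of role & role
| RUnion of role & role
| RStar of role
| RTest of concept
| RInv of role
| RUniv
with concept : Type :=
| CConst of {i01 R}
| CName of CN
| CAnd of concept & concept
| CImp of concept & concept
| CNeg of concept
| COr of concept & concept
| CInvol of concept
| CForall of role & concept
| CExists of role & concept
| CNominal of IN
| CSelf of RN
| CGeQ of nat & role & concept
| CLtQ of nat & role & concept
| CGeN of nat & role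
| CLtN of nat & role.

Definition basic_role (Phi : set feature) (rho : role) : Prop :=
  match rho with
  | RName _ => True
  | RInv (RName _) => Phi FI
  | _ => False
  end.

Fixpoint role_in (Phi : set feature) (rho : role) : Prop :=
  match rho with
  | RName _ => True
  | RComp rho1 rho2 | RUnion rho1 rho2 => role_in Phi rho1 /\ role_in Phi rho2
  | RStar rho1 => role_in Phi rho1
  | RTest C => concept_in Phi C
  | RInv rho1 => Phi FI /\ role_in Phi rho1
  | RUniv => Phi FU
  end
with concept_in (Phi : set feature) (C : concept) : Prop :=
  match C with
  | CConst _ | CName _ => True
  | CAnd C1 C2 | CImp C1 C2 | COr C1 C2 =>
      concept_in Phi C1 /\ concept_in Phi C2
  | CNeg C1 | CInvol C1 => concept_in Phi C1
  | CForall rho C1 | CExists rho C1 => role_in Phi rho /\ concept_in Phi C1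
  | CNominal _ => Phi FO
  | CSelf _ => Phi FSelf
  | CGeQ n rho C1 | CLtQ n rho C1 =>
      [/\ Phi (FQ n), basic_role Phi rho & concept_in Phi C1]
  | CGeN n rho | CLtN n rho => Phi (FN n) /\ basic_role Phi rho
  end.

Inductive comparison : Type := CmpGe | CmpGt.

Record gci : Type := Gci {
  gci_lhs : concept;
  gci_rhs : concept;
  gci_cmp : comparison;
  gci_bound : R }.

Definition gci_in (Phi : set feature) (g : gci) : Prop :=
  [/\ concept_in Phi (gci_lhs g), concept_in Phi (gci_rhs g)
    & 0 < gci_bound g <= 1].

Definition fuzzy_tbox (Phi : set feature) (T : set gci) : Prop :=
  finite_set T /\ (forall g, T g -> gci_in Phi g).

End Syntax.

Arguments RName {R CN RN IN}.
Arguments RUniv {R CN RN IN}.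
Arguments CConst {R CN RN IN}.
Arguments CName {R CN RN IN}.
Arguments CNominal {R CN RN IN}.
Arguments CSelf {R CN RN IN}.

Record interp (R : realType) (CN RN IN : Type) : Type := Interp {
  dom :> Type;
  dom_nonempty : inhabited dom;
  ind : IN -> dom;
  con : CN -> dom -> {i01 R};
  rol : RN -> dom -> dom -> {i01 R} }.

Arguments ind {R CN RN IN}.
Arguments con {R CN RN IN}.
Arguments rol {R CN RN IN}.

(* The sets whose supremum or infimum is taken in the semantics.  They are
   subsets of [0, 1] as soon as their arguments take values in [0, 1], and they
   are nonempty when D is, except for [ge_vals], which is empty if D has fewer
   than n elements; [sup set0 = 0] is then the supremum in [0, 1]. *)
Section ValueSets.
Context (R : realType) (D : Type).
Implicit Types (f g : D -> D -> R) (c : D -> R) (x y : D) (n : nat).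

Definition comp_vals f g x y : set R :=
  [set gand (f x z) (g z y) | z in [set: D]].

Definition star_vals f x y : set R :=
  [set v | exists (n : nat) (z : nat -> D),
    [/\ z 0%N = x, z n = y & v = gmin (fun i : 'I_n => f (z i) (z i.+1))]].

Definition exists_vals f c x : set R :=
  [set gand (f x y) (c y) | y in [set: D]].

Definition forall_vals f c x : set R :=
  [set gimp (f x y) (c y) | y in [set: D]].

Definition ge_vals n f c x : set R :=
  [set gmin (fun i => gand (f x (y i)) (c (y i))) |
    y in [set y : 'I_n -> D | injective y]].

Definition repeats n (y : 'I_n -> D) : Prop :=
  exists j k : 'I_n, (j < k)%N /\ y j = y k.

Definition lt_vals n f c x : set R :=
  [set gimp (gmin (fun i => gand (f x (y i)) (c (y i))))
            (if `[< repeats y >] then 1 else 0) |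
    y in [set: 'I_n -> D]].

End ValueSets.

Section Semantics.
Context (R : realType) (CN RN IN : Type) (I : interp R CN RN IN).
Local Notation role := (role R CN RN IN).
Local Notation concept := (concept R CN RN IN).

Fixpoint role_val (rho : role) : I -> I -> R :=
  match rho with
  | RName r => fun x y => (rol I r x y)%:num
  | RComp rho1 rho2 => fun x y => sup (comp_vals (role_val rho1) (role_val rho2) x y)
  | RUnion rho1 rho2 => fun x y => gor (role_val rho1 x y) (role_val rho2 x y)
  | RStar rho1 => fun x y => sup (star_vals (role_val rho1) x y)
  | RTest C => fun x y => if `[< x = y >] then concept_val C x else 0
  | RInv rho1 => fun x y => role_val rho1 y x
  | RUniv => fun _ _ => 1
  end
with concept_val (C : concept) : I -> R :=
  match C with
  | CConst p => fun _ => p%:num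
  | CName A => fun x => (con I A x)%:num
  | CAnd C1 C2 => fun x => gand (concept_val C1 x) (concept_val C2 x)
  | CImp C1 C2 => fun x => gimp (concept_val C1 x) (concept_val C2 x)
  | CNeg C1 => fun x => gneg (concept_val C1 x)
  | COr C1 C2 => fun x => gor (concept_val C1 x) (concept_val C2 x)
  | CInvol C1 => fun x => 1 - concept_val C1 x
  | CForall rho C1 => fun x => inf (forall_vals (role_val rho) (concept_val C1) x)
  | CExists rho C1 => fun x => sup (exists_vals (role_val rho) (concept_val C1) x)
  | CNominal a => fun x => if `[< x = ind I a >] then 1 else 0
  | CSelf r => fun x => (rol I r x x)%:num
  | CGeQ n rho C1 => fun x => sup (ge_vals n (role_val rho) (concept_val C1) x)
  | CLtQ n rho C1 => fun x => inf (lt_vals n (role_val rho) (concept_val C1) x)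
  | CGeN n rho => fun x => sup (ge_vals n (role_val rho) (fun=> 1) x)
  | CLtN n rho => fun x => inf (lt_vals n (role_val rho) (fun=> 1) x)
  end.

Definition role_witnessed (rho : role) : Prop :=
  match rho with
  | RComp rho1 rho2 => forall x y,
      let A := comp_vals (role_val rho1) (role_val rho2) x y in
      infinite_set A -> has_greatest A
  | RStar rho1 => forall x y,
      let A := star_vals (role_val rho1) x y in
      infinite_set A -> has_greatest A
  | _ => True
  end.

Definition concept_witnessed (C : concept) : Prop :=
  match C with
  | CForall rho C1 => forall x,
      let A := forall_vals (role_val rho) (concept_val C1) x in
      infinite_set A -> has_least A
  | CExists rho C1 => forall x,
      let A := exists_vals (role_val rho) (concept_val C1) x in
      infinite_set A -> has_greatest A
  | CGeQ n rho C1 => forall x,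
      let A := ge_vals n (role_val rho) (concept_val C1) x in
      infinite_set A -> has_greatest A
  | CLtQ n rho C1 => forall x,
      let A := lt_vals n (role_val rho) (concept_val C1) x in
      infinite_set A -> has_least A
  | CGeN n rho => forall x,
      let A := ge_vals n (role_val rho) (fun=> 1) x in
      infinite_set A -> has_greatest A
  | CLtN n rho => forall x,
      let A := lt_vals n (role_val rho) (fun=> 1) x in
      infinite_set A -> has_least A
  | _ => True
  end.

Definition witnessed (Phi : set feature) : Prop :=
  (forall rho, role_in Phi rho -> role_witnessed rho) /\
  (forall C, concept_in Phi C -> concept_witnessed C).

Definition phi_connected (Phi : set feature) : Prop :=
  forall x : I, exists (a : IN) (n : nat) (z : nat -> I) (rho : 'I_n -> role),
    [/\ z 0%N = ind I a, z n = x
      & forall i : 'I_n, basic_role Phi (rho i) /\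
                         0 < role_val (rho i) (z i) (z i.+1)].

Definition cmp_holds (c : comparison) (v p : R) : Prop :=
  match c with CmpGe => v >= p | CmpGt => v > p end.

Definition validates_gci (g : gci R CN RN IN) : Prop :=
  forall x : I,
    cmp_holds (gci_cmp g) (concept_val (CImp (gci_lhs g) (gci_rhs g)) x)
              (gci_bound g).

Definition validates (T : set (gci R CN RN IN)) : Prop :=
  forall g, T g -> validates_gci g.

End Semantics.

Section Bisimulation.
Context (R : realType) (CN RN IN : Type) (Phi : set feature).
Context (I I' : interp R CN RN IN).
Local Notation role := (role R CN RN IN).

Section Relation.
Context (Z : I -> I' -> bool).

Definition crisp_val (x : I) (x' : I') : R := (Z x x')%:R.
Local Notation z := crisp_val.

Record crisp_bisimulation : Prop := CrispBisimulation {
  bisim_con : forall x x' (A : CN),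
    z x x' <= giff (con I A x)%:num (con I' A x')%:num;
  bisim_forth : forall x x' (rho : role), basic_role Phi rho ->
    forall y, exists y',
      gand (z x x') (role_val rho x y) <= gand (z y y') (role_val rho x' y');
  bisim_back : forall x x' (rho : role), basic_role Phi rho ->
    forall y', exists y,
      gand (z x x') (role_val rho x' y') <= gand (z y y') (role_val rho x y);
  bisim_O : Phi FO -> forall x x' (a : IN),
    (x = ind I a /\ x' <> ind I' a) \/ (x <> ind I a /\ x' = ind I' a) ->
    z x x' = 0;
  bisim_U : Phi FU -> forall x x',
    (forall y, exists y', z x x' <= z y y') /\
    (forall y', exists y, z x x' <= z y y');
  bisim_Self : Phi FSelf -> forall x x' (r : RN),
    z x x' <= giff (rol I r x x)%:num (rol I' r x' x')%:num;
  bisim_Q_forth : forall n, Phi (FQ n) ->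
    forall x x' (rho : role), basic_role Phi rho ->
    forall y : 'I_n -> I, 0 < z x x' -> injective y ->
    (forall j, 0 < role_val rho x (y j)) ->
    exists2 y' : 'I_n -> I', injective y' &
      forall i, exists j,
        gand (z x x') (gmin (fun k => role_val rho x (y k)))
        <= gand (z (y j) (y' i)) (role_val rho x' (y' i));
  bisim_Q_back : forall n, Phi (FQ n) ->
    forall x x' (rho : role), basic_role Phi rho ->
    forall y' : 'I_n -> I', 0 < z x x' -> injective y' ->
    (forall j, 0 < role_val rho x' (y' j)) ->
    exists2 y : 'I_n -> I, injective y &
      forall i, exists j,
        gand (z x x') (gmin (fun k => role_val rho x' (y' k)))
        <= gand (z (y i) (y' j)) (role_val rho x (y i));
  bisim_N_forth : forall n, Phi (FN n) ->
    forall x x' (rho : role), basic_role Phi rho ->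
    forall y : 'I_n -> I, 0 < z x x' -> injective y ->
    (forall j, 0 < role_val rho x (y j)) ->
    exists2 y' : 'I_n -> I', injective y' &
      forall i,
        gand (z x x') (gmin (fun k => role_val rho x (y k)))
        <= role_val rho x' (y' i);
  bisim_N_back : forall n, Phi (FN n) ->
    forall x x' (rho : role), basic_role Phi rho ->
    forall y' : 'I_n -> I', 0 < z x x' -> injective y' ->
    (forall j, 0 < role_val rho x' (y' j)) ->
    exists2 y : 'I_n -> I, injective y &
      forall i,
        gand (z x x') (gmin (fun k => role_val rho x' (y' k)))
        <= role_val rho x (y i) }.

End Relation.

Definition strongly_bisimilar : Prop :=
  inhabited IN /\
  exists2 Z : I -> I' -> bool, crisp_bisimulation Z &
    forall a : IN, Z (ind I a) (ind I' a) = true.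

End Bisimulation.

(* Main.v *)
(** Let [Z] be a crisp bisimulation.  By simultaneous induction, [Z]-related
    points give every concept the same value, and for every role [rho], every
    positive value [rho x y] and every [x'] related to [x] there is [y'] related
    to [y] with [rho x y <= rho x' y'].  Witnessedness makes the suprema defining
    composition and iteration attained, so a single path carries the whole value
    and can be transferred step by step.  Connectedness lets one transfer a path
    from a named individual to any given point, hence every point is related to
    some point of the other interpretation, and each GCI takes the same values
    in both. *)

Require Import Defs.
From HB Require Import structures.
From mathcomp Require Import all_boot all_order all_algebra.
From mathcomp Require Import all_classical all_reals interval_inference.

Set Implicit Arguments.
Unset Strict Implicit.
Unset Printing Implicit Defensive.

Import Order.TTheory GRing.Theory Num.Theory.

Local Open Scope classical_set_scope.
Local Open Scope ring_scope.

(** * Gödel operations, suprema and infima in the unit interval *)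

Section GoedelLemmas.
Context (R : realType).
Implicit Types (p q r : R) (A B : set R).

Definition unit_valued (p : R) : Prop := 0 <= p <= 1.

Lemma unit_valued0 : unit_valued 0.
Proof. by rewrite /unit_valued lexx ler01. Qed.

Lemma unit_valued1 : unit_valued 1.
Proof. by rewrite /unit_valued lexx ler01. Qed.

Lemma le_gand r p q : (r <= gand p q) = (r <= p) && (r <= q).
Proof. exact: le_min. Qed.

Lemma lt_gand r p q : (r < gand p q) = (r < p) && (r < q).
Proof. exact: lt_min. Qed.

Lemma gandC : commutative (@gand R).
Proof. exact: minC. Qed.

Lemma gand1l p : p <= 1 -> gand 1 p = p.
Proof. by move=> p1; apply: min_r. Qed.

Lemma gand_unit p q : unit_valued p -> unit_valued q -> unit_valued (gand p q).
Proof.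
rewrite /unit_valued le_gand => /andP[p0 p1] /andP[q0 q1].
by rewrite p0 q0 ge_min p1.
Qed.

Lemma gor_unit p q : unit_valued p -> unit_valued q -> unit_valued (gor p q).
Proof.
rewrite /unit_valued /gor => /andP[p0 p1] /andP[q0 q1].
by rewrite le_max p0 ge_max p1 q1.
Qed.

Lemma gimp_unit p q : unit_valued q -> unit_valued (gimp p q).
Proof. by rewrite /gimp; case: ifP => // _ _; apply: unit_valued1. Qed.

Lemma gimp_ge p q : q <= 1 -> q <= gimp p q.
Proof. by rewrite /gimp; case: ifP. Qed.

Lemma gimp0l q : 0 <= q -> gimp 0 q = 1.
Proof. by rewrite /gimp => ->. Qed.

Lemma gimp_le2r p p' q : q <= 1 -> p <= p' -> gimp p' q <= gimp p q.
Proof.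
move=> q1 pp'; rewrite /gimp; case: ifP => [p'q|_]; last exact: gimp_ge.
by rewrite (le_trans pp' p'q).
Qed.

(** If [p] and [q] differed, one of the two implications would equal the smaller of them, which is
    below 1. At points related by a crisp bisimulation this turns the bounds on names and on [Self]
    into equalities. *)
Lemma giff_ge1 p q : p <= 1 -> q <= 1 -> 1 <= giff p q -> p = q.
Proof.
move=> p1 q1; rewrite le_gand /gimp.
have [pq|qp] := leP p q; last first.
  by case/andP=> /le_lt_trans/(_ qp); rewrite ltNge p1.
have [qp _|pq'] := leP q p; first exact/le_anti/andP.
by case/andP=> _ /le_lt_trans/(_ pq'); rewrite ltNge q1.
Qed.

Lemma giffC p q : giff p q = giff q p.
Proof. exact: minC. Qed.

Lemma le_gmin n (f : 'I_n -> R) r :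
  r <= 1 -> (forall i, r <= f i) -> r <= gmin f.
Proof. by move=> r1 rf; apply: le_bigmin. Qed.

Lemma gmin_le n (f : 'I_n -> R) i : gmin f <= f i.
Proof. exact: bigmin_le. Qed.

Lemma gmin_le1 n (f : 'I_n -> R) : gmin f <= 1.
Proof. exact: bigmin_le_id. Qed.

Lemma gmin_unit n (f : 'I_n -> R) :
  (forall i, unit_valued (f i)) -> unit_valued (gmin f).
Proof.
move=> f01; rewrite /unit_valued gmin_le1 andbT.
by apply: le_gmin => // i; case/andP: (f01 i).
Qed.

Lemma ub_le_sup_unit A p : A `<=` unit_valued -> A p -> p <= sup A.
Proof.
by move=> A01; apply: ub_le_sup; exists 1 => q /A01 /andP[].
Qed.

Lemma ge_inf_unit A p : A `<=` unit_valued -> A p -> inf A <= p.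
Proof.
by move=> A01; apply: ge_inf; exists 0 => q /A01 /andP[].
Qed.

Lemma sup_unit A : A `<=` unit_valued -> unit_valued (sup A).
Proof.
move=> A01; have [->|/set0P A0] := eqVneq A set0.
  by rewrite sup0; apply: unit_valued0.
apply/andP; split; last by apply: ge_sup => // q /A01 /andP[].
have [p Ap] := A0; apply: le_trans (ub_le_sup_unit A01 Ap).
by case/andP: (A01 _ Ap).
Qed.

Lemma inf_unit A : A !=set0 -> A `<=` unit_valued -> unit_valued (inf A).
Proof.
move=> A0 A01; apply/andP; split.
  by apply: lb_le_inf => // q /A01 /andP[].
have [p Ap] := A0; apply: le_trans (ge_inf_unit A01 Ap) _.
by case/andP: (A01 _ Ap).
Qed.

(** Elements of [A] that are at most 0 lie below [sup B] anyway, so only positive values have to be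
    transferred. An empty set is covered because its [sup] is 0. *)
Lemma le_sup_unit A B : B `<=` unit_valued ->
  (forall p, A p -> 0 < p -> exists2 q, B q & p <= q) -> sup A <= sup B.
Proof.
move=> B01 AB; have /andP[supB0 _] := sup_unit B01.
have [->|/set0P A0] := eqVneq A set0; first by rewrite sup0.
apply: ge_sup => // p Ap; have [p0|p0] := leP p 0; first exact: le_trans p0 _.
have [q Bq pq] := AB p Ap p0; exact: le_trans pq (ub_le_sup_unit B01 Bq).
Qed.

Lemma le_inf_unit A B : A `<=` unit_valued -> B !=set0 ->
  (forall p, B p -> exists2 q, A q & q <= p) -> inf A <= inf B.
Proof.
move=> A01 B0 BA; apply: lb_le_inf => // p /BA[q Aq]; apply: le_trans.
exact: ge_inf_unit.
Qed.

Lemma seq_has_max (s : seq R) :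
  s != [::] -> exists2 m, m \in s & {in s, forall p, p <= m}.
Proof.
elim: s => // p s IHs _; have [->|/IHs[m ms mmax]] := eqVneq s [::].
  by exists p; rewrite ?mem_head // => q; rewrite inE => /eqP->.
have [pm|mp] := leP p m.
  exists m; first by rewrite inE ms orbT.
  by move=> q; rewrite inE => /predU1P[->//|/mmax].
exists p; first exact: mem_head.
move=> q; rewrite inE => /predU1P[->//|/mmax qm].
exact: le_trans qm (ltW mp).
Qed.

(** A nonempty finite set has a maximum, so a condition on infinite sets alone makes every nonempty
    set attain its supremum. *)
Lemma sup_attained A : A !=set0 ->
  (infinite_set A -> has_greatest A) -> A (sup A).
Proof.
move=> A0 infA; have [m [Am mub]] : has_greatest A.
  have [|//] := pselect (finite_set A) => /finite_seqP[s As].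
  have [|m ms mmax] := @seq_has_max s.
    by have [p] := A0; rewrite As /=; case: s {As}.
  by exists m; rewrite As; split.
suff -> : sup A = m by [].
apply/le_anti/andP; split; first exact: ge_sup.
by apply: ub_le_sup => //; exists m.
Qed.

End GoedelLemmas.

(** * Converses, bounds and nonemptiness of the value sets *)

Section ValueSetLemmas.
Context (R : realType) (D : Type).
Implicit Types (f g : D -> D -> R) (c : D -> R) (x y : D) (n : nat).

Definition converse f x y := f y x.

Lemma comp_vals_converse f g x y :
  comp_vals f g y x = comp_vals (converse g) (converse f) x y.
Proof. by apply: eq_imagel => z _; rewrite gandC. Qed.

(** A path read backwards from its end is a path for the converse relation, and its edge values are
    the same in reverse order. Step [i] of one path is step [rev_ord i] of the other. *)
Lemma star_vals_converse_sub f x y :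
  star_vals f y x `<=` star_vals (converse f) x y.
Proof.
move=> v [n [z [z0 zn ->]]]; exists n, (fun i => z (n - i)%N).
split; rewrite ?subn0 ?subnn //; apply/le_anti/andP; split.
  apply: le_gmin (gmin_le1 _) _ => i.
  apply: le_trans (gmin_le _ (rev_ord i)) _.
  by rewrite /converse /= subnSK.
apply: le_gmin (gmin_le1 _) _ => i; apply: le_trans (gmin_le _ (rev_ord i)) _.
by rewrite /converse /= subKn // subnSK // subKn // ltnW.
Qed.

Lemma star_vals_converse f x y :
  star_vals f y x = star_vals (converse f) x y.
Proof.
apply/seteqP; split; first exact: star_vals_converse_sub.
exact: (@star_vals_converse_sub (converse f)).
Qed.

Lemma comp_vals_unit f g x y :
  (forall u v, unit_valued (f u v)) -> (forall u v, unit_valued (g u v)) ->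
  comp_vals f g x y `<=` @unit_valued R.
Proof. by move=> f01 g01 _ [z _ <-]; apply: gand_unit. Qed.

Lemma star_vals_unit f x y : (forall u v, unit_valued (f u v)) ->
  star_vals f x y `<=` @unit_valued R.
Proof. by move=> f01 _ [n [z [_ _ ->]]]; apply: gmin_unit. Qed.

Lemma star_vals_neq0 f x y : star_vals f x y !=set0.
Proof.
(* The direct path of length one from [x] to [y]; the empty path would require [x = y]. *)
exists (gmin (fun i : 'I_1 => f (if i == 0%N :> nat then x else y) y)).
exists 1%N, (fun i => if i == 0%N then x else y); split => //.
Qed.

Lemma exists_vals_unit f c x :
  (forall u v, unit_valued (f u v)) -> (forall u, unit_valued (c u)) ->
  exists_vals f c x `<=` @unit_valued R.
Proof. by move=> f01 c01 _ [z _ <-]; apply: gand_unit. Qed.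

Lemma forall_vals_unit f c x : (forall u, unit_valued (c u)) ->
  forall_vals f c x `<=` @unit_valued R.
Proof. by move=> c01 _ [z _ <-]; apply: gimp_unit. Qed.

Lemma ge_vals_unit n f c x :
  (forall u v, unit_valued (f u v)) -> (forall u, unit_valued (c u)) ->
  ge_vals n f c x `<=` @unit_valued R.
Proof.
by move=> f01 c01 _ [y _ <-]; apply: gmin_unit => i; apply: gand_unit.
Qed.

Lemma lt_vals_unit n f c x : lt_vals n f c x `<=` @unit_valued R.
Proof.
move=> _ [y _ <-]; apply: gimp_unit.
by case: ifP => _; [apply: unit_valued1|apply: unit_valued0].
Qed.

Lemma lt_vals_neq0 n f c x : lt_vals n f c x !=set0.
Proof. exact/image_nonempty/(@ex_intro _ _ (fun=> x)). Qed.

Lemma injectiveN_repeats n (y : 'I_n -> D) : injective y <-> ~ repeats y.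
Proof.
split=> [yI [j [k [jk /yI]]] eq_jk|nrep j k eqy].
  by rewrite eq_jk ltnn in jk.
by have [jk|kj|/val_inj//] := ltngtP j k; case: nrep; [exists j, k|exists k, j].
Qed.

End ValueSetLemmas.

(** * Transfer of positive role values along a crisp relation *)

Section Simulation.
Context (R : realType) (D D' : Type) (Z : D -> D' -> bool).
Implicit Types n : nat.

(** The restriction to positive values reflects what the forth condition gives: at value 0 its
    inequality does not force [y] and [y'] to be related. *)
Definition simulates (f : D -> D -> R) (f' : D' -> D' -> R) : Prop :=
  forall x x' y, Z x x' -> 0 < f x y ->
  exists2 y', Z y y' & f x y <= f' x' y'.

(** Attainment on the left yields one intermediate point [z] that carries the whole supremum; both
    steps through it are then simulated in turn. On the right it is enough that the supremum is an
    upper bound. *)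
Lemma simulates_comp f f' g g' :
  (forall x y, comp_vals f g x y (sup (comp_vals f g x y))) ->
  (forall x y, unit_valued (f' x y)) -> (forall x y, unit_valued (g' x y)) ->
  simulates f f' -> simulates g g' ->
  simulates (fun x y => sup (comp_vals f g x y))
            (fun x y => sup (comp_vals f' g' x y)).
Proof.
move=> att f01 g01 ff' gg' x x' y Zx.
have [z _ <-] := att x y; rewrite lt_gand => /andP[fz gz].
have [z' Zz fz'] := ff' _ _ _ Zx fz; have [y' Zy gz'] := gg' _ _ _ Zz gz.
exists y' => //; apply: (@le_trans _ _ (gand (f' x' z') (g' z' y'))).
  by rewrite le_gand !ge_min fz' gz' orbT.
by apply: ub_le_sup_unit; [exact: comp_vals_unit|exists z'].
Qed.

Lemma simulates_union f f' g g' : simulates f f' -> simulates g g' ->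
  simulates (fun x y => gor (f x y) (g x y)) (fun x y => gor (f' x y) (g' x y)).
Proof.
move=> ff' gg' x x' y Zx; rewrite /gor.
have [fg|gf] := leP (f x y) (g x y) => /[dup] pos.
  by move=> /(gg' _ _ _ Zx)[y' Zy le]; exists y'; rewrite // le_max le orbT.
by move=> /(ff' _ _ _ Zx)[y' Zy le]; exists y'; rewrite // le_max le.
Qed.

(** The positive bound [v] is fixed in advance and does not depend on the length, so the induction
    can extend the path by one edge, itself positive and hence simulated. *)
Lemma simulates_path f f' v x x' n (z : nat -> D) :
  simulates f f' -> 0 < v -> Z x x' -> z 0%N = x ->
  (forall i, (i < n)%N -> v <= f (z i) (z i.+1)) ->
  exists z' : nat -> D', [/\ z' 0%N = x', Z (z n) (z' n)
    & forall i, (i < n)%N -> v <= f' (z' i) (z' i.+1)].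
Proof.
move=> ff' v0 Zx z0; elim: n => [|n IHn] vf.
  by exists (fun=> x'); split; rewrite ?z0.
have [i lt_in|z' [z'0 Zn vf']] := IHn; first exact/vf/ltnW.
have vn := vf n (ltnSn n).
have [y' Zy fy'] := ff' _ _ (z n.+1) Zn (lt_le_trans v0 vn).
(* The new path follows the old one up to index [n] and continues with [y']; the only new edge is
   the one at [i = n]. *)
exists (fun i => if (i <= n)%N then z' i else y'); split => //.
  by rewrite ltnn.
move=> i /=; rewrite ltnS {1}leq_eqVlt => /predU1P[->|lt_in].
  by rewrite leqnn ltnn; apply: le_trans fy'.
by rewrite (ltnW lt_in) lt_in; apply: vf'.
Qed.

Lemma simulates_star f f' :
  (forall x y, star_vals f x y (sup (star_vals f x y))) ->
  (forall x y, unit_valued (f' x y)) -> simulates f f' ->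
  simulates (fun x y => sup (star_vals f x y))
            (fun x y => sup (star_vals f' x y)).
Proof.
move=> att f01 ff' x x' y Zx; have [n [z [z0 zn ->]]] := att x y => v0.
have [i lt_in|z' [z'0 Zn vf']] := simulates_path ff' v0 Zx z0 (n := n).
  exact: (gmin_le _ (Ordinal lt_in)).
exists (z' n); first by rewrite -zn.
apply: (@le_trans _ _ (gmin (fun i : 'I_n => f' (z' i) (z' i.+1)))).
  by apply: le_gmin (gmin_le1 _) _ => i; apply: vf'.
by apply: ub_le_sup_unit; [exact: star_vals_unit|exists n, z'].
Qed.

Lemma simulates_test c c' : (forall x x', Z x x' -> c x = c' x') ->
  simulates (fun x y => if `[< x = y >] then c x else 0)
            (fun x y => if `[< x = y >] then c' x else 0).
Proof.
move=> cc' x x' y Zx; case: asboolP => [<- _|_]; last by rewrite ltxx.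
by exists x'; rewrite // asboolT ?(cc' _ _ Zx).
Qed.

Lemma simulates_exists_le f f' c c' x x' :
  (forall u v, unit_valued (f' u v)) -> (forall u, unit_valued (c' u)) ->
  simulates f f' -> (forall y y', Z y y' -> c y = c' y') -> Z x x' ->
  sup (exists_vals f c x) <= sup (exists_vals f' c' x').
Proof.
move=> f01 c01 ff' cc' Zx; apply: le_sup_unit; first exact: exists_vals_unit.
move=> _ [y _ <-]; rewrite lt_gand => /andP[fy _].
have [y' Zy fy'] := ff' _ _ _ Zx fy.
exists (gand (f' x' y') (c' y')); first by exists y'.
by rewrite le_gand !ge_min fy' (cc' _ _ Zy) lexx orbT.
Qed.

Lemma simulates_forall_ge f f' c c' x x' :
  (forall u v, unit_valued (f u v)) -> (forall u, unit_valued (c u)) ->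
  (forall u, unit_valued (c' u)) ->
  simulates f f' -> (forall y y', Z y y' -> c y = c' y') -> Z x x' ->
  inf (forall_vals f' c' x') <= inf (forall_vals f c x).
Proof.
move=> f01 c01 c'01 ff' cc' Zx; apply: le_inf_unit.
- exact: forall_vals_unit.
- exact/image_nonempty/(@ex_intro _ _ x).
move=> _ [y _ <-]; have /andP[fy0 _] := f01 x y; have /andP[cy0 cy1] := c01 y.
move: fy0; rewrite le_eqVlt => /predU1P[<-|/(ff' _ _ _ Zx)[y' Zy fy']].
  (* For [f x y = 0] there may be no partner of [y], but the implication is then 1, which bounds any
     element of the other set; [x'] supplies one. *)
  rewrite gimp0l //; exists (gimp (f' x' x') (c' x')); first by exists x'.
  by case/andP: (gimp_unit (f' x' x') (c'01 x')).
(* The consequents agree, and the implication decreases in its antecedent. *)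
exists (gimp (f' x' y') (c' y')); first by exists y'.
by rewrite -(cc' _ _ Zy); apply: gimp_le2r.
Qed.

(* What the counting conditions of a bisimulation provide: the qualified ones
   for [c] and [c'] that agree along [Z], the unqualified ones for [c = 1]. *)
Definition counts_simulate n (f : D -> D -> R) (f' : D' -> D' -> R)
    (c : D -> R) (c' : D' -> R) (x : D) (x' : D') : Prop :=
  forall y : 'I_n -> D, injective y ->
    let v := gmin (fun i => gand (f x (y i)) (c (y i))) in 0 < v ->
    exists2 y' : 'I_n -> D', injective y' &
      v <= gmin (fun i => gand (f' x' (y' i)) (c' (y' i))).

Lemma counts_simulate_ge_le n f f' c c' x x' :
  (forall u v, unit_valued (f' u v)) -> (forall u, unit_valued (c' u)) ->
  counts_simulate n f f' c c' x x' ->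
  sup (ge_vals n f c x) <= sup (ge_vals n f' c' x').
Proof.
move=> f01 c01 cnt; apply: le_sup_unit; first exact: ge_vals_unit.
move=> _ [y yI <-] /(cnt y yI)[y' y'I le].
by exists (gmin (fun i => gand (f' x' (y' i)) (c' (y' i)))) => //; exists y'.
Qed.

(** Every element of [lt_vals] is 0 or 1, and it is 0 exactly for an injective tuple with positive
    minimum. Such tuples are what [counts_simulate] transfers. *)
Lemma counts_simulate_lt_ge n f f' c c' x x' :
  counts_simulate n f f' c c' x x' ->
  inf (lt_vals n f' c' x') <= inf (lt_vals n f c x).
Proof.
move=> cnt; apply: le_inf_unit; [exact: lt_vals_unit|exact: lt_vals_neq0|].
(* An element equal to 1 is bounded below by any element of the other set. *)
have top p : 1 <= p -> exists2 q, lt_vals n f' c' x' q & q <= p.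
  have [q Aq] := lt_vals_neq0 n f' c' x' => p1; exists q => //.
  by apply: le_trans p1; case/andP: (lt_vals_unit Aq).
move=> _ [y _ <-]; case: asboolP => [_|/injectiveN_repeats yI].
  by apply: top; rewrite /gimp gmin_le1.
rewrite /gimp; case: ifP => [_|/negbT]; first exact: top.
rewrite -ltNge => v0; have [y' y'I le] := cnt y yI v0.
exists 0 => //; exists y' => //; rewrite asboolF; last exact/injectiveN_repeats.
by rewrite /gimp leNgt (lt_le_trans v0 le).
Qed.

End Simulation.

(** * Range of the semantics and attained suprema *)

Section Values.
Context (R : realType) (CN RN IN : Type) (I : interp R CN RN IN).

Scheme role_mut := Induction for role Sort Prop
with concept_mut := Induction for concept Sort Prop.
Combined Scheme role_concept_ind from role_mut, concept_mut.

(** This makes every set under a [sup] or [inf] bounded, so that these operators really return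
    bounds. Roles and concepts are treated together because tests embed concepts in roles. *)
Lemma role_concept_val_unit :
  (forall (rho : role R CN RN IN) (x y : I), unit_valued (role_val rho x y)) /\
  (forall (C : concept R CN RN IN) (x : I), unit_valued (concept_val C x)).
Proof.
have ifb (b : bool) (p : R) : unit_valued p -> unit_valued (if b then p else 0).
  by case: b => // _; apply: unit_valued0.
have i01 (p : {i01 R}) : unit_valued p%:num by rewrite /unit_valued ge0 le1.
apply: role_concept_ind => /=.
- by [].
- by move=> rho1 IH1 rho2 IH2 x y; exact/sup_unit/comp_vals_unit.
- by move=> rho1 IH1 rho2 IH2 x y; exact: gor_unit.
- by move=> rho IH x y; exact/sup_unit/star_vals_unit.
- by move=> C IH x y; exact: ifb.
- by move=> rho IH x y.
- by move=> _ _; exact: unit_valued1.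
- by [].
- by [].
- by move=> C1 IH1 C2 IH2 x; exact: gand_unit.
- by move=> C1 IH1 C2 IH2 x; exact: gimp_unit.
- by move=> C IH x; exact/ifb/unit_valued1.
- by move=> C1 IH1 C2 IH2 x; exact: gor_unit.
- move=> C IH x; have /andP[C0 C1] := IH x.
  by rewrite /unit_valued subr_ge0 C1 gerBl.
- move=> rho IHr C IHc x; apply: inf_unit; last exact: forall_vals_unit.
  exact/image_nonempty/(@ex_intro _ _ x).
- by move=> rho IHr C IHc x; exact/sup_unit/exists_vals_unit.
- by move=> a x; exact/ifb/unit_valued1.
- by [].
- by move=> n rho IHr C IHc x; exact/sup_unit/ge_vals_unit.
- move=> n rho IHr C IHc x; apply: inf_unit; first exact: lt_vals_neq0.
  exact: lt_vals_unit.
- move=> n rho IHr x; apply/sup_unit/ge_vals_unit => // _.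
  exact: unit_valued1.
- move=> n rho IHr x; apply: inf_unit; first exact: lt_vals_neq0.
  exact: lt_vals_unit.
Qed.

Definition role_val_unit := role_concept_val_unit.1.
Definition concept_val_unit := role_concept_val_unit.2.

Lemma comp_attained (Phi : set feature) (rho1 rho2 : role R CN RN IN) (x y : I) :
  witnessed I Phi -> role_in Phi rho1 -> role_in Phi rho2 ->
  let A := comp_vals (role_val rho1) (role_val rho2) x y in A (sup A).
Proof.
move=> [wr _] in1 in2; apply: sup_attained; last exact: (wr (RComp rho1 rho2)).
exact/image_nonempty/(@ex_intro _ _ x).
Qed.

Lemma star_attained (Phi : set feature) (rho : role R CN RN IN) (x y : I) :
  witnessed I Phi -> role_in Phi rho ->
  let A := star_vals (role_val rho) x y in A (sup A).
Proof.
move=> [wr _] inr; apply: sup_attained; last exact: (wr (RStar rho)).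
exact: star_vals_neq0.
Qed.

End Values.

(** * Consequences of the bisimulation conditions *)

Section Bisimulations.
Context (R : realType) (CN RN IN : Type) (Phi : set feature).
Implicit Types I : interp R CN RN IN.

(** The forth and back conditions exchange places and the others are symmetric. Hence each
    inequality below is proved in one direction only. *)
Lemma bisim_sym I I' (Z : I -> I' -> bool) :
  crisp_bisimulation Phi Z -> crisp_bisimulation Phi (fun x' x => Z x x').
Proof.
move=> [con forth back O U Self Qf Qb Nf Nb]; split.
- by move=> x' x A; rewrite giffC; apply: con.
- by move=> x' x; apply: back.
- by move=> x' x; apply: forth.
- by move=> fO x' x a xa; apply: (O fO x x' a); tauto.
- by move=> fU x' x; have [] := U fU x x'.
- by move=> fS x' x r; rewrite giffC; apply: Self.
- by move=> n fn x' x; apply: Qb.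
- by move=> n fn x' x; apply: Qf.
- by move=> n fn x' x; apply: Nb.
- by move=> n fn x' x; apply: Nf.
Qed.

Section Forth.
Context I I' (Z : I -> I' -> bool) (bZ : crisp_bisimulation Phi Z).

Lemma crisp_val1 x x' : Z x x' -> crisp_val Z x x' = 1.
Proof. by rewrite /crisp_val => ->. Qed.

Lemma gt0_crisp_val x x' : 0 < crisp_val Z x x' -> Z x x'.
Proof. by rewrite /crisp_val; case: (Z x x') => //; rewrite ltxx. Qed.

Lemma le_gand_crisp_val x x' (p q : R) :
  0 < p -> p <= gand (crisp_val Z x x') q -> Z x x' /\ p <= q.
Proof.
move=> p0; rewrite le_gand => /andP[pZ pq]; split=> //.
exact/gt0_crisp_val/(lt_le_trans p0).
Qed.

(** Since [Z x x'] has value 1, the left side of the forth condition is the role value itself; being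
    positive, it forces [Z y y']. *)
Lemma basic_role_simulates rho : basic_role Phi rho ->
  simulates Z (@role_val R CN RN IN I rho) (@role_val R CN RN IN I' rho).
Proof.
move=> rhoB x x' y Zx f0; have [y'] := bisim_forth bZ x x' rhoB y.
have /andP[_ f1] := role_val_unit rho x y.
by rewrite crisp_val1 // gand1l // => /le_gand_crisp_val[]// ? ?; exists y'.
Qed.

Lemma univ_simulates : Phi FU ->
  simulates Z (@role_val R CN RN IN I RUniv) (@role_val R CN RN IN I' RUniv).
Proof.
move=> fU x x' y Zx _; have [/(_ y)[y']] := bisim_U bZ fU x x'.
rewrite crisp_val1 // => le _; exists y' => //.
exact/gt0_crisp_val/(lt_le_trans ltr01).
Qed.

Lemma bisim_nominal x x' a : Phi FO -> Z x x' ->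
  x = ind I a <-> x' = ind I' a.
Proof.
move=> fO Zx; have := bisim_O bZ fO (x := x) (x' := x') (a := a).
rewrite crisp_val1 // => nom.
have {}nom : ~ (x = ind I a /\ x' <> ind I' a \/ x <> ind I a /\ x' = ind I' a).
  (* If exactly one of the two points were named by [a], then [Z x x'] would have value 0. *)
  by move=> /nom/eqP; rewrite oner_eq0.
by have [|] := pselect (x = ind I a); have [|] := pselect (x' = ind I' a); tauto.
Qed.

(** Each [y' i] is related to some [y j] and so has the same value of [C] as it. Distinct [i] may
    share one [j]: [v] bounds the value of [C] at every [y j]. *)
Lemma geQ_simulates n rho C x x' :
  Phi (FQ n) -> basic_role Phi rho -> Z x x' ->
  (forall y y', Z y y' -> concept_val C y = concept_val C y') ->
  counts_simulate n (@role_val R CN RN IN I rho) (@role_val R CN RN IN I' rho)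
    (concept_val C) (concept_val C) x x'.
Proof.
move=> fn rhoB Zx CC y yI v v0.
have le_v i : v <= role_val rho x (y i) /\ v <= concept_val C (y i).
  have := gmin_le (fun i => gand (role_val rho x (y i)) (concept_val C (y i))) i.
  by rewrite -/v le_gand => /andP[].
have [||y' y'I yy'] := bisim_Q_forth bZ fn rhoB (x := x) (x' := x') _ yI.
- by rewrite crisp_val1.
- by move=> j; apply: lt_le_trans v0 (le_v j).1.
exists y' => //; apply: le_gmin (gmin_le1 _) _ => i.
have [j] := yy' i; rewrite crisp_val1 // gand1l ?gmin_le1 // => le.
have {}le : v <= gand (crisp_val Z (y j) (y' i)) (role_val rho x' (y' i)).
  apply: le_trans le; apply: le_gmin (gmin_le1 _) _ => k.
  exact: (le_v k).1.
have [Zy le_r] := le_gand_crisp_val v0 le.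
by rewrite le_gand le_r -(CC _ _ Zy) (le_v j).2.
Qed.

Lemma geN_simulates n rho x x' :
  Phi (FN n) -> basic_role Phi rho -> Z x x' ->
  counts_simulate n (@role_val R CN RN IN I rho) (@role_val R CN RN IN I' rho)
    (fun=> 1) (fun=> 1) x x'.
Proof.
move=> fn rhoB Zx y yI v v0.
have le_v i : v <= role_val rho x (y i).
  have := gmin_le (fun i => gand (role_val rho x (y i)) 1) i.
  by rewrite -/v le_gand => /andP[].
have [||y' y'I yy'] := bisim_N_forth bZ fn rhoB (x := x) (x' := x') _ yI.
- by rewrite crisp_val1.
- by move=> j; apply: lt_le_trans v0 (le_v j).
exists y' => //; apply: le_gmin (gmin_le1 _) _ => i.
rewrite le_gand gmin_le1 andbT; apply: le_trans (yy' i).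
rewrite crisp_val1 // gand1l ?gmin_le1 //.
by apply: le_gmin (gmin_le1 _) _ => k.
Qed.

Lemma connected_related x :
  phi_connected I Phi -> (forall a, Z (ind I a) (ind I' a)) ->
  exists x', Z x x'.
Proof.
move=> cI Zind; have [a [n [z [rho [z0 <- rhoP]]]]] := cI x.
(* All points of the path are claimed to have partners, so that the induction runs from the named
   individual towards [x]. *)
suff : forall k, (k <= n)%N -> exists x', Z (z k) x' by apply.
elim=> [|k IHk] lt_kn; first by exists (ind I' a); rewrite z0.
have [x' Zx] := IHk (ltnW lt_kn).
have [rhoB pos] := rhoP (Ordinal lt_kn).
by have [y' Zy _] := basic_role_simulates rhoB Zx pos; exists y'.
Qed.

End Forth.

(** * Invariance of roles and concepts under bisimulation *)

Section Invariance.
Context I I' (Z : I -> I' -> bool) (bZ : crisp_bisimulation Phi Z).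
Context (wI : witnessed I Phi) (wI' : witnessed I' Phi).
Let Z' x' x := Z x x'.
Let bZ' : crisp_bisimulation Phi Z' := bisim_sym bZ.

Definition bisimulates (f : I -> I -> R) (f' : I' -> I' -> R) : Prop :=
  simulates Z f f' /\ simulates Z' f' f.

(* Inverses of arbitrary roles are roles, so the induction has to carry the
   simulation of the converse relation along when [FI] is a feature. *)
Let orient T (b : bool) (f : T -> T -> R) :=
  if b then converse f else f.

(** Tests need equality of concept values, and quantifiers need simulations in both directions, one
    for each inequality. The converse is claimed only under [FI], where inverses of role names are
    basic roles. *)
Lemma role_concept_invariance :
  (forall rho : role R CN RN IN, role_in Phi rho ->
    forall b : bool, (b -> Phi FI) ->
    bisimulates (orient b (role_val rho)) (orient b (role_val rho))) /\
  (forall C : concept R CN RN IN, concept_in Phi C ->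
    forall x x', Z x x' -> concept_val C x = concept_val C x').
Proof.
have r01 J (rho : role R CN RN IN) b x y :
    unit_valued (orient b (@role_val R CN RN IN J rho) x y).
  by case: b; apply: role_val_unit.
have c01 J (C : concept R CN RN IN) := @concept_val_unit R CN RN IN J C.
apply: role_concept_ind => /=.
- move=> r _ [/(_ isT) fI|_].
    by split; [apply: (basic_role_simulates bZ (rho := RInv (RName r)))
              |apply: (basic_role_simulates bZ' (rho := RInv (RName r)))].
  by split; [apply: (basic_role_simulates bZ (rho := RName r))
            |apply: (basic_role_simulates bZ' (rho := RName r))].
- move=> rho1 IH1 rho2 IH2 [in1 in2] b bI.
  have [s1 s1'] := IH1 in1 b bI; have [s2 s2'] := IH2 in2 b bI.
  have att (J : interp R CN RN IN) (wJ : witnessed J Phi) (x y : J) :=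
    comp_attained x y wJ in1 in2.
  (* The converse of a composition composes the converses in the opposite order. *)
  have compE (J : interp R CN RN IN) : orient b (fun x y : J =>
      sup (comp_vals (role_val rho1) (role_val rho2) x y)) =
    fun x y : J => sup (comp_vals
      (orient b (role_val (if b then rho2 else rho1)))
      (orient b (role_val (if b then rho1 else rho2))) x y).
    case: b {bI s1 s1' s2 s2'} => //; apply/funext => x; apply/funext => y.
    by rewrite /orient {1}/converse comp_vals_converse.
  (* The set of values for the reversed composition is that of the original one with swapped
     endpoints, so attainment carries over. *)
  have {}att (J : interp R CN RN IN) (wJ : witnessed J Phi) (x y : J) :
    let A := comp_vals
      (orient b (role_val (if b then rho2 else rho1)))
      (orient b (role_val (if b then rho1 else rho2))) x y in A (sup A).
    case: b {bI s1 s1' s2 s2' compE} => /=; last exact: att.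
    by rewrite -comp_vals_converse; apply: att.
  rewrite !compE; split; apply: simulates_comp => //.
  + exact: att.
  + by case: (b) s1 s2.
  + by case: (b) s1 s2.
  + exact: att.
  + by case: (b) s1' s2'.
  + by case: (b) s1' s2'.
- move=> rho1 IH1 rho2 IH2 [in1 in2] b bI.
  have [s1 s1'] := IH1 in1 b bI; have [s2 s2'] := IH2 in2 b bI.
  by case: b {bI} s1 s1' s2 s2' => s1 s1' s2 s2'; split;
    [apply: simulates_union s1 s2|apply: simulates_union s1' s2'
    |apply: simulates_union s1 s2|apply: simulates_union s1' s2'].
- move=> rho IH inr b bI; have [s s'] := IH inr b bI.
  have starE (J : interp R CN RN IN) :
    orient b (fun x y : J => sup (star_vals (role_val rho) x y)) =
    fun x y : J => sup (star_vals (orient b (role_val rho)) x y).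
    case: b {bI s s'} => //; apply/funext => x; apply/funext => y.
    by rewrite /orient {1}/converse star_vals_converse.
  have att (J : interp R CN RN IN) (wJ : witnessed J Phi) (x y : J) :
    let A := star_vals (orient b (role_val rho)) x y in A (sup A).
    case: b {bI s s' starE} => /=; last exact: star_attained wJ inr.
    by rewrite -star_vals_converse; apply: star_attained wJ inr.
  rewrite !starE; split; apply: simulates_star => //; exact: att.
- move=> C IH inC b bI.
  (* A test is supported on the diagonal, hence equal to its own converse. *)
  have testE (J : interp R CN RN IN) : orient b (fun x y : J =>
      if `[< x = y >] then concept_val C x else 0) =
    fun x y : J => if `[< x = y >] then concept_val C x else 0.
    case: b {bI} => //; apply/funext => x; apply/funext => y.
    rewrite /orient /converse; case: asboolP => [->|ne]; first by rewrite asboolT.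
    by rewrite asboolF // => /esym.
  rewrite !testE; split; apply: simulates_test; first exact: IH.
  by move=> x' x Zx; apply/esym/IH.
(* An inverse flips the orientation, and [FI] is available from membership of the role in the
   language. *)
- move=> rho IH [fI inr] b bI; have [] := IH inr (~~ b) (fun=> fI).
  by case: b {bI}.
- move=> fU b _; have univE (J : interp R CN RN IN) :
    orient b (fun _ _ : J => 1) = fun _ _ => 1.
    by case: b.
  by rewrite !univE; split; [apply: (univ_simulates bZ fU)
                            |apply: (univ_simulates bZ' fU)].
- by [].
- move=> A _ x x' Zx; apply: giff_ge1 => //.
  by have := bisim_con bZ x x' A; rewrite crisp_val1.
- move=> C1 IH1 C2 IH2 [/IH1{}IH1 /IH2{}IH2] x x' Zx.
  by rewrite (IH1 _ x') ?(IH2 _ x').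
- move=> C1 IH1 C2 IH2 [/IH1{}IH1 /IH2{}IH2] x x' Zx.
  by rewrite (IH1 _ x') ?(IH2 _ x').
- by move=> C IH /IH{}IH x x' Zx; rewrite (IH _ x').
- move=> C1 IH1 C2 IH2 [/IH1{}IH1 /IH2{}IH2] x x' Zx.
  by rewrite (IH1 _ x') ?(IH2 _ x').
- by move=> C IH /IH{}IH x x' Zx; rewrite (IH _ x').
- move=> rho IHr C IHc [/IHr/(_ false)[//|s s'] /IHc{}IHc] x x' Zx.
  (* For a universal restriction, the inequality from [x] to [x'] uses the simulation of [I'] by
     [I], and the other one uses the simulation of [I] by [I']. *)
  apply/le_anti/andP; split.
    apply: (@simulates_forall_ge _ _ _ Z') => //.
    + exact: (r01 _ _ false).
    + by move=> y' y Zy; apply/esym/IHc.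
  by apply: (@simulates_forall_ge _ _ _ Z) => //; exact: (r01 _ _ false).
- move=> rho IHr C IHc [/IHr/(_ false)[//|s s'] /IHc{}IHc] x x' Zx.
  apply/le_anti/andP; split.
    by apply: (@simulates_exists_le _ _ _ Z) => //; exact: (r01 _ _ false).
  apply: (@simulates_exists_le _ _ _ Z') => //.
  + exact: (r01 _ _ false).
  + by move=> y' y Zy; apply/esym/IHc.
- move=> a fO x x' Zx; have xx' := bisim_nominal bZ a fO Zx.
  by do 2 case: asboolP => //; tauto.
- move=> r fS x x' Zx; apply: giff_ge1 => //.
  by have := bisim_Self bZ fS x x' r; rewrite crisp_val1.
- move=> n rho _ C IHc [fn rhoB /IHc{}IHc] x x' Zx.
  (* The role is basic, so the counting conditions of [Z] and of its converse apply directly, given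
     agreement on [C] in both directions. *)
  have IHc' y' y : Z' y' y -> concept_val C y' = concept_val C y.
    by move=> Zy; apply/esym/IHc.
  apply/le_anti/andP; split; apply: counts_simulate_ge_le => //.
  + exact: (r01 _ _ false).
  + exact: (geQ_simulates bZ fn rhoB Zx IHc).
  + exact: (r01 _ _ false).
  + exact: (geQ_simulates bZ' fn rhoB Zx IHc').
- move=> n rho _ C IHc [fn rhoB /IHc{}IHc] x x' Zx.
  have IHc' y' y : Z' y' y -> concept_val C y' = concept_val C y.
    by move=> Zy; apply/esym/IHc.
  apply/le_anti/andP; split; apply: counts_simulate_lt_ge.
  + exact: (geQ_simulates bZ' fn rhoB Zx IHc').
  + exact: (geQ_simulates bZ fn rhoB Zx IHc).
- move=> n rho _ [fn rhoB] x x' Zx.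
  apply/le_anti/andP; split; apply: counts_simulate_ge_le => //.
  + exact: (r01 _ _ false).
  + by move=> _; exact: unit_valued1.
  + exact: (geN_simulates bZ fn rhoB Zx).
  + exact: (r01 _ _ false).
  + by move=> _; exact: unit_valued1.
  + exact: (geN_simulates bZ' fn rhoB Zx).
- move=> n rho _ [fn rhoB] x x' Zx.
  apply/le_anti/andP; split; apply: counts_simulate_lt_ge.
  + exact: (geN_simulates bZ' fn rhoB Zx).
  + exact: (geN_simulates bZ fn rhoB Zx).
Qed.

End Invariance.

(** * Transfer of TBox validity *)

Lemma bisim_validates I I' (Z : I -> I' -> bool) (T : set (gci R CN RN IN)) :
  crisp_bisimulation Phi Z -> witnessed I Phi -> witnessed I' Phi ->
  (forall g, T g -> gci_in Phi g) -> (forall x', exists x, Z x x') ->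
  validates I T -> validates I' T.
Proof.
move=> bZ wI wI' TPhi cov valT g Tg x'; have [x Zx] := cov x'.
have [inl inr _] := TPhi g Tg.
(* The implication evaluated by a GCI is itself a concept of the language, so invariance applies to
   it as a whole. *)
have inC : concept_in Phi (CImp (gci_lhs g) (gci_rhs g)) by [].
have := valT g Tg x.
by rewrite ((role_concept_invariance bZ wI wI').2 _ inC _ _ Zx).
Qed.

End Bisimulations.

Theorem theorem7 (R : realType) (CN RN IN : Type) (Phi : set feature)
    (hPhi : Phi `<=` features)
    (T : set (gci R CN RN IN)) (hT : fuzzy_tbox Phi T)
    (I I' : interp R CN RN IN)
    (wI : witnessed I Phi) (wI' : witnessed I' Phi)
    (bisim : strongly_bisimilar Phi I I')
    (cI : phi_connected I Phi) (cI' : phi_connected I' Phi) :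
  validates I T <-> validates I' T.
Proof.
have [_ [Z bZ Zind]] := bisim; have [_ TPhi] := hT.
split.
  (* Going from [I] to [I'], each point of [I'] needs a partner in [I]; this comes from the
     connectedness of [I'], the target. *)
  apply: (bisim_validates bZ) => // x'.
  exact: (connected_related (bisim_sym bZ) x' cI').
apply: (bisim_validates (bisim_sym bZ)) => // x.
exact: (connected_related bZ x cI).
Qed.
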